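(* Let $\rho,\gamma$ be states of a physical system $A$, where $\gamma=\gamma^A$ is the Gibbs state of $A$, and let $\varepsilon\in[0,1]$. Then $$\mathrm{Distill}^\varepsilon_{\mathrm{GPC}}(\rho,\gamma)=D_{\min}^\varepsilon\left(\mathcal{P}(\rho)\big\|\gamma\right).$$
   Context: Systems are finite dimensional with Hamiltonians; for fixed inverse temperature $\beta>0$ the Gibbs state of $X$ is $\gamma^X=e^{-\beta H^X}/\mathrm{Tr}[e^{-\beta H^X}]$. Writing $H^A=\sum_x a_x\Pi_x$ with distinct eigenvalues $a_x$ and spectral projectors $\Pi_x$, the pinching channel is $\mathcal{P}(\rho)=\sum_x\Pi_x\rho\Pi_x$. A channel $\mathcal{E}:A\to B$ is in $\mathrm{GPC}(A\to B)$ if $\mathcal{E}(\gamma^A)=\gamma^B$ and $\mathcal{E}(e^{-iH^At}\omega e^{iH^At})=e^{-iH^Bt}\mathcal{E}(\omega)e^{iH^Bt}$ for all $t\in\mathbb{R}$ and states $\omega$. For real $m\ge1$, let $X$ be a qubit system with Hamiltonian diagonal in $\{|0\rangle,|1\rangle\}$ whose Gibbs state is $\mathbf{u}_m^X\coloneqq\frac1m|0\rangle\langle0|+\frac{m-1}{m}|1\rangle\langle1|$. The conversion distance is $d_{\mathrm{GPC}}((\rho^A,\gamma^A)\to(\sigma^B,\gamma^B))\coloneqq\min_{\mathcal{E}\in\mathrm{GPC}(A\to B)}\frac12\|\sigma^B-\mathcal{E}(\rho^A)\|_1$, and $\mathrm{Distill}^\varepsilon_{\mathrm{GPC}}(\rho,\gamma)\coloneqq\log\sup\{m>0: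 d_{\mathrm{GPC}}((\rho,\gamma)\to(|0\rangle\langle0|^X,\mathbf{u}^X_m))\le\varepsilon\}$. The hypothesis testing divergence is $D_{\min}^\varepsilon(\rho\|\gamma)\coloneqq-\log\min\{\mathrm{Tr}[\gamma\Lambda]:0\le\Lambda\le I,\ \mathrm{Tr}[\Lambda\rho]\ge1-\varepsilon\}$. Logarithms are base 2. *)

(* Defs.v *)
From HB Require Import structures.
From mathcomp Require Import all_boot all_order all_algebra.
From mathcomp Require Import complex.
From mathcomp Require Import all_classical all_reals.
From mathcomp Require Import ereal sequences exp trigo.

Set Implicit Arguments.
Unset Strict Implicit.
Unset Printing Implicit Defensive.

Import Order.TTheory GRing.Theory Num.Theory.
Local Open Scope ring_scope.
Local Open Scope complex_scope.

Section QDefs.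
Variable R : realType.
Notation C := R[i].

Definition adj {m n} (A : 'M[C]_(m, n)) : 'M[C]_(n, m) := map_mx conjc (A^T).

(* positive semidefinite: v^* A v >= 0 for every vector v (in C, "0 <= z"
   means z is a nonnegative real) *)
Definition psd {N} (A : 'M[C]_N) : Prop :=
  forall v : 'cV[C]_N, 0 <= (adj v *m A *m v) ord0 ord0.

Definition is_state {N} (rho : 'M[C]_N) : Prop := psd rho /\ \tr rho = 1.

Definition is_hermitian {N} (H : 'M[C]_N) : Prop := adj H = H.

Definition is_linear {n m} (E : 'M[C]_n -> 'M[C]_m) : Prop :=
  forall (a : C) (X Y : 'M[C]_n), E (a *: X + Y) = a *: E X + E Y.

(* completely positive: id_k (x) E maps positive block matrices
   [B_ij]_{i,j<k} to positive block matrices [E(B_ij)]_{i,j<k}, for all k *)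
Definition is_CP {n m} (E : 'M[C]_n -> 'M[C]_m) : Prop :=
  forall (k : nat) (B : 'I_k -> 'I_k -> 'M[C]_n),
    psd (\mxblock_(i < k, j < k) B i j) ->
    psd (\mxblock_(i < k, j < k) E (B i j)).

Definition is_TP {n m} (E : 'M[C]_n -> 'M[C]_m) : Prop :=
  forall X, \tr (E X) = \tr X.

Definition is_channel {n m} (E : 'M[C]_n -> 'M[C]_m) : Prop :=
  is_linear E /\ is_CP E /\ is_TP E.

(* Functional calculus of a Hermitian (normal) matrix via the spectral
   theorem of mathcomp: H = U^-1 diag(lambda) U with U = spectralmx H. *)
Definition eigs {N} (H : 'M[C]_N) : 'rV[C]_N := spectral_diag H.

Definition fun_mx {N} (f : R -> C) (H : 'M[C]_N) : 'M[C]_N :=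
  invmx (spectralmx H) *m diag_mx (\row_i f (complex.Re (eigs H 0 i))) *m spectralmx H.

Definition expm_neg (beta : R) {N} (H : 'M[C]_N) : 'M[C]_N :=
  fun_mx (fun x => (expR (- (beta * x)))%:C) H.

Definition gibbs (beta : R) {N} (H : 'M[C]_N) : 'M[C]_N :=
  (\tr (expm_neg beta H))^-1 *: expm_neg beta H.

Definition evo {N} (H : 'M[C]_N) (t : R) : 'M[C]_N :=
  fun_mx (fun x => (cos (x * t) +i* (- sin (x * t)))) H.

Definition eigproj {N} (H : 'M[C]_N) (a : C) : 'M[C]_N :=
  invmx (spectralmx H) *m diag_mx (\row_i (eigs H 0 i == a)%:R) *m spectralmx H.

Definition pinching {N} (H : 'M[C]_N) (rho : 'M[C]_N) : 'M[C]_N :=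
  \sum_(a <- undup [seq eigs H 0 i | i <- enum 'I_N])
     eigproj H a *m rho *m eigproj H a.

Definition trnorm {m n} (X : 'M[C]_(m, n)) : R :=
  complex.Re (\sum_i sqrtC (eigs (X *m adj X) 0 i)).

(* Gibbs-preserving covariant channels; the target Gibbs state gB and
   Hamiltonian HB are given separately (needed for the qubit X at m = 1) *)
Definition GPC {n m} (HA : 'M[C]_n) (gA : 'M[C]_n) (HB : 'M[C]_m)
    (gB : 'M[C]_m) (E : 'M[C]_n -> 'M[C]_m) : Prop :=
  is_channel E /\ E gA = gB /\
  forall (t : R) (w : 'M[C]_n), is_state w ->
    E (evo HA t *m w *m evo HA (- t)) = evo HB t *m E w *m evo HB (- t).

(* conversion distance (the min is written as an infimum; it is attained) *)
Definition dGPC {n m} (HA gA : 'M[C]_n) (rho : 'M[C]_n)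
    (HB gB : 'M[C]_m) (sigma : 'M[C]_m) : \bar R :=
  ereal_inf [set ((trnorm (sigma - E rho)) / 2)%:E
            | E in [set E : 'M[C]_n -> 'M[C]_m | GPC HA gA HB gB E]].

Definition ket0proj : 'M[C]_2 := diag_mx (\row_(i < 2) (i == 0 :> nat)%:R).

Definition u_m (m : R) : 'M[C]_2 :=
  diag_mx (\row_(i < 2) (if i == 0 :> nat then m^-1 else (m - 1) / m)%:C).

(* diagonal Hamiltonian diag(0, -ln(m-1)/beta), whose Gibbs state is u_m
   for m > 1 (for m = 1, ln 0 = 0 by convention) *)
Definition H_X (beta m : R) : 'M[C]_2 :=
  diag_mx (\row_(i < 2) (if i == 0 :> nat then 0 else - (ln (m - 1) / beta))%:C).

Definition elog2 (x : \bar R) : \bar R :=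
  match x with
  | EFin r => if (0 < r)%R then EFin (ln r / ln 2) else -oo%E
  | +oo%E => +oo%E
  | -oo%E => -oo%E
  end.

Definition Distill (beta : R) {n} (HA : 'M[C]_n) (rho : 'M[C]_n) (eps : R)
    : \bar R :=
  elog2 (ereal_sup [set m%:E | m in
    [set m : R | 1 <= m /\
       (dGPC HA (gibbs beta HA) rho (H_X beta m) (u_m m) ket0proj
          <= eps%:E)%E]]).

Definition Dmin (eps : R) {n} (rho gamma : 'M[C]_n) : \bar R :=
  (- elog2 (ereal_inf [set (complex.Re (\tr (gamma *m L)))%:E | L in
     [set L : 'M[C]_n | psd L /\ psd (1%:M - L) /\
        (1 - eps <= complex.Re (\tr (L *m rho)))%R]]))%E.

End QDefs.

(* Main.v *)
Require Import Defs.
From HB Require Import structures.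
From mathcomp Require Import all_boot all_order all_algebra.
From mathcomp Require Import complex.
From mathcomp Require Import all_classical all_reals.
From mathcomp Require Import ereal sequences exp trigo.
From mathcomp Require Import ring lra.
Import Order.TTheory GRing.Theory Num.Theory.
Local Open Scope ring_scope.
Local Open Scope complex_scope.

(* A covariant channel into the qubit X is seen by the target |0><0| only
   through the effect L = E^dagger(|0><0|). Covariance makes L invariant under
   the time evolution, so L is block diagonal and Tr[L rho] = Tr[L P(rho)];
   Gibbs preservation says Tr[L gamma] = 1/m, and the trace distance of E(rho)
   to |0><0| is at least 1 - Tr[L rho]. Conversely, a pinched effect L gives the
   measure-and-prepare channel
     w |-> Tr[L w] |0><0| + Tr[(1 - L) w] |1><1|,
   which is Gibbs preserving and covariant for m = 1 / Tr[L gamma] and has trace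
   distance exactly 1 - Tr[L P(rho)].
   The conversion distance is an infimum, so the first argument only provides
   effects whose error exceeds eps by any d > 0. The excess is removed by mixing
   with the identity if eps > 0, and by compressing 1 - L to the kernel of
   P(rho) if eps = 0. *)

(** * Adjoints, quadratic forms and positive semidefinite matrices *)

Section PositiveSemidefinite.
Context {R : realType}.
Local Notation C := R[i].

Lemma adjmxE m n (A : 'M[C]_(m, n)) i j : adj A i j = conjc (A j i).
Proof. by rewrite !mxE. Qed.

Lemma adj_trmxC m n (A : 'M[C]_(m, n)) : adj A = map_mx Num.conj A^T.
Proof. by []. Qed.

Lemma adjmxK m n (A : 'M[C]_(m, n)) : adj (adj A) = A.
Proof. by apply/matrixP => i j; rewrite !adjmxE conjcK. Qed.

Lemma adjmxM m n p (A : 'M[C]_(m, n)) (B : 'M[C]_(n, p)) :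
  adj (A *m B) = adj B *m adj A.
Proof. by rewrite /adj trmx_mul map_mxM. Qed.

Lemma adjmxD m n (A B : 'M[C]_(m, n)) : adj (A + B) = adj A + adj B.
Proof. by rewrite /adj linearD map_mxD. Qed.

Lemma adjmxB m n (A B : 'M[C]_(m, n)) : adj (A - B) = adj A - adj B.
Proof. by rewrite /adj linearB map_mxB. Qed.

Lemma adjmxZ m n a (A : 'M[C]_(m, n)) : adj (a *: A) = conjc a *: adj A.
Proof. by rewrite /adj linearZ map_mxZ. Qed.

Lemma adjmx1 n : adj (1%:M : 'M[C]_n) = 1%:M.
Proof. by rewrite /adj trmx1 map_mx1. Qed.

Lemma adj_diag n (d : 'rV[C]_n) : adj (diag_mx d) = diag_mx (map_mx conjc d).
Proof. by rewrite /adj tr_diag_mx map_diag_mx. Qed.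

Lemma invmx_spectralmx n (A : 'M[C]_n) :
  invmx (spectralmx A) = adj (spectralmx A).
Proof. exact/invmx_unitary/spectral_unitarymx. Qed.

Lemma addmxE m n (A B : 'M[C]_(m, n)) i j : (A + B) i j = A i j + B i j.
Proof. by rewrite mxE. Qed.

Lemma oppmxE m n (A : 'M[C]_(m, n)) i j : (- A) i j = - A i j.
Proof. by rewrite mxE. Qed.

Lemma scalemxE m n a (A : 'M[C]_(m, n)) i j : (a *: A) i j = a * A i j.
Proof. by rewrite mxE. Qed.

Lemma quad_form_trace n (A : 'M[C]_n) (v : 'cV_n) :
  (adj v *m A *m v) ord0 ord0 = \tr (A *m (v *m adj v)).
Proof. by rewrite -trace_mx11 -mulmxA mxtrace_mulC mulmxA. Qed.

Lemma quad_form_delta n (A : 'M[C]_n) (i j : 'I_n) (a b : C) :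
  let v := a *: delta_mx i 0 + b *: delta_mx j 0 : 'cV_n in
  (adj v *m A *m v) ord0 ord0 =
    conjc a * a * A i i + conjc a * b * A i j +
    conjc b * a * A j i + conjc b * b * A j j.
Proof.
have H (k l : 'I_n) :
    adj (delta_mx k 0 : 'cV[C]_n) *m A *m (delta_mx l 0 : 'cV[C]_n)
      = (A k l)%:M.
  apply/matrixP => a0 b0; rewrite !ord1.
  by rewrite -colE !mxE (bigD1 k) //= big1 ?addr0 ?adjmxE ?mxE ?eqxx
    ?conjc1 ?mul1r ?mulr1n // => x xk; rewrite adjmxE mxE (negPf xk) conjc0 mul0r.
rewrite /= adjmxD !adjmxZ !mulmxDl !mulmxDr -!scalemxAl -!scalemxAr.
rewrite !H; move: (A i i) (A i j) (A j i) (A j j) => x y z t.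
by rewrite !mxE !mulr1n; ring.
Qed.

Lemma quad_form_unit n (A : 'M[C]_n) (i : 'I_n) :
  (adj (delta_mx i 0 : 'cV_n) *m A *m (delta_mx i 0 : 'cV_n)) ord0 ord0
    = A i i.
Proof.
have := quad_form_delta n A i i 1 0; cbv zeta.
by rewrite scale1r scale0r addr0 conjc1 conjc0 !(mul0r, mul1r, mulr0, addr0).
Qed.

(** Complex polarization. Unit vectors kill the diagonal; e_i + e_j gives A_ij + A_ji = 0, while e_i
    + i e_j gives A_ij - A_ji = 0. *)
Lemma quad_form_eq0 n (A : 'M[C]_n) :
  (forall v : 'cV_n, (adj v *m A *m v) ord0 ord0 = 0) -> A = 0.
Proof.
move=> A0; apply/matrixP => i j; rewrite mxE.
have d k : A k k = 0 by rewrite -quad_form_unit.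
have := A0 (1 *: delta_mx i 0 + 1 *: delta_mx j 0).
have := A0 (1 *: delta_mx i 0 + 'i%C *: delta_mx j 0).
rewrite !quad_form_delta !d conjc1 !(mulr0, mul1r, addr0, add0r) mulr1.
have -> : conjc 'i%C = - 'i%C :> C by simpc.
move=> h1 h2.
have {}h2 : A j i = - A i j by apply/eqP; rewrite -addr_eq0 addrC h2.
move: h1; rewrite h2 mulNr mulrN opprK -mulr2n => /eqP.
rewrite mulrn_eq0 /= mulf_eq0 => /orP[|/eqP//].
by rewrite eq_complex /= oner_eq0 andbF.
Qed.

Lemma quad_form_conj n (A : 'M[C]_n) (v : 'cV_n) :
  (adj v *m adj A *m v) ord0 ord0 = conjc ((adj v *m A *m v) ord0 ord0).
Proof. by rewrite -adjmxE !adjmxM adjmxK mulmxA. Qed.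

(** Positivity in C includes reality, so [adj A - A] has vanishing quadratic form, and polarization
    applies. *)
Lemma psd_hermitian n (A : 'M[C]_n) : psd A -> adj A = A.
Proof.
move=> A0; apply/eqP; rewrite -subr_eq0; apply/eqP/quad_form_eq0 => v.
rewrite mulmxBr mulmxBl addmxE oppmxE quad_form_conj.
have := A0 v; case: (_ ord0 ord0) => a b; rewrite lecE /= => /andP[/eqP -> _].
by rewrite oppr0 subrr.
Qed.

Lemma psd_conj m n (A : 'M[C]_n) (X : 'M[C]_(n, m)) :
  psd A -> psd (adj X *m A *m X).
Proof. by move=> A0 v; have := A0 (X *m v); rewrite adjmxM !mulmxA. Qed.

Lemma psdD n (A B : 'M[C]_n) : psd A -> psd B -> psd (A + B).
Proof.
by move=> A0 B0 v; rewrite mulmxDr mulmxDl addmxE addr_ge0 ?A0 ?B0.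
Qed.

Lemma psdZ n (a : C) (A : 'M[C]_n) : 0 <= a -> psd A -> psd (a *: A).
Proof.
by move=> a0 A0 v; rewrite -scalemxAr -scalemxAl scalemxE mulr_ge0 ?A0.
Qed.

Lemma psd_diag n (d : 'rV[C]_n) : (forall i, 0 <= d 0 i) -> psd (diag_mx d).
Proof.
move=> d0 v; rewrite mul_mx_diag mxE; apply: sumr_ge0 => i _.
by rewrite mxE adjmxE mulrAC mulr_ge0 // mulrC mulcJ_ge0.
Qed.

Lemma psd1 n : psd (1%:M : 'M[C]_n).
Proof. by rewrite -diag_const_mx; apply: psd_diag => i; rewrite mxE. Qed.

Lemma psd_rank1 n (v : 'cV[C]_n) : psd (v *m adj v).
Proof.
by move=> w; rewrite -mulmxA -mulmxA mulmxA -{1}[v]adjmxK -adjmxM mxE big_ord1 adjmxE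
  mulrC mulcJ_ge0.
Qed.

Lemma psd_diag_ge0 n (A : 'M[C]_n) i : psd A -> 0 <= A i i.
Proof. by move=> /(_ (delta_mx i 0)); rewrite quad_form_unit. Qed.

Lemma psd_trace_ge0 n (A : 'M[C]_n) : psd A -> 0 <= \tr A.
Proof. by move=> A0; apply: sumr_ge0 => i _; exact: psd_diag_ge0. Qed.

Lemma hermitian_spectral n (A : 'M[C]_n) : adj A = A ->
  A = adj (spectralmx A) *m diag_mx (eigs A) *m spectralmx A.
Proof.
move=> hA; rewrite -invmx_spectralmx; apply/orthomx_spectralP/normalmxP.
by rewrite -adj_trmxC hA.
Qed.

Lemma mul_spectralmx_adj n (A : 'M[C]_n) :
  spectralmx A *m adj (spectralmx A) = 1%:M.
Proof. exact/unitarymxP/spectral_unitarymx. Qed.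

Lemma mul_adj_spectralmx n (A : 'M[C]_n) :
  adj (spectralmx A) *m spectralmx A = 1%:M.
Proof. by rewrite -invmx_spectralmx mulVmx ?spectral_unit. Qed.

Lemma spectral_diagE n (A : 'M[C]_n) : adj A = A ->
  spectralmx A *m A *m adj (spectralmx A) = diag_mx (eigs A).
Proof.
move=> hA; rewrite {2}(hermitian_spectral _ _ hA) !mulmxA mul_spectralmx_adj.
by rewrite mul1mx -mulmxA mul_spectralmx_adj mulmx1.
Qed.

Lemma psd_eigs_ge0 n (A : 'M[C]_n) i : psd A -> 0 <= eigs A 0 i.
Proof.
move=> A0; have := spectral_diagE _ _ (psd_hermitian _ _ A0).
move=> /matrixP/(_ i i); rewrite [RHS]mxE eqxx mulr1n => <-.
apply: psd_diag_ge0; rewrite -{1}[spectralmx A]adjmxK.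
exact: psd_conj.
Qed.

Lemma hermitian_eigs_real n (A : 'M[C]_n) i : adj A = A ->
  eigs A 0 i = (complex.Re (eigs A 0 i))%:C.
Proof.
move=> hA; have := spectral_diagE _ _ hA => /(congr1 (fun M => adj M)).
rewrite !adjmxM adjmxK hA mulmxA spectral_diagE // adj_diag => /matrixP/(_ i i).
rewrite !mxE eqxx !mulr1n; case: (eigs _ _ _) => a b [] /= bN.
by congr (_ +i* _); lra.
Qed.

(** The vectors adj(U) e_l, with U = [spectralmx A], are an orthonormal eigenbasis of [A], so this
    is the spectral decomposition of [A] inserted into the trace. *)
Lemma psd_trace_mulE n (A B : 'M[C]_n) : psd A ->
  \tr (A *m B) = \sum_l eigs A 0 l *
    (adj (adj (spectralmx A) *m (delta_mx l 0 : 'cV_n)) *m B *m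
      (adj (spectralmx A) *m (delta_mx l 0 : 'cV_n))) ord0 ord0.
Proof.
move=> A0; rewrite {1}(hermitian_spectral _ _ (psd_hermitian _ _ A0)).
rewrite -!mulmxA mxtrace_mulC -!mulmxA mul_diag_mx; apply: eq_bigr => l _.
rewrite mxE; congr (_ * _); rewrite adjmxM adjmxK.
rewrite !mulmxA -[X in X *m delta_mx l 0]mulmxA -[X in X *m delta_mx l 0]mulmxA.
by rewrite quad_form_unit !mulmxA.
Qed.

Lemma psd_trace_mul_ge0 n (A B : 'M[C]_n) :
  psd A -> psd B -> 0 <= \tr (A *m B).
Proof.
move=> A0 B0; rewrite psd_trace_mulE //; apply: sumr_ge0 => l _.
by rewrite mulr_ge0 ?psd_eigs_ge0.
Qed.

End PositiveSemidefinite.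

(** * Pinching, time evolution and the Gibbs state in an energy eigenbasis *)

Section EnergyEigenbasis.
Context {R : realType}.
Local Notation C := R[i].

(** The matrix of [X] in the eigenbasis of [H]. There functions of [H] are diagonal, pinching keeps
    or deletes single entries, and time evolution multiplies them by phases. *)
Definition frame {n} (H X : 'M[C]_n) : 'M[C]_n :=
  spectralmx H *m X *m adj (spectralmx H).

Lemma frameK n (H X : 'M[C]_n) :
  adj (spectralmx H) *m frame H X *m spectralmx H = X.
Proof.
by rewrite /frame !mulmxA mul_adj_spectralmx mul1mx -mulmxA mul_adj_spectralmx
  mulmx1.
Qed.

Lemma frame_inj n (H : 'M[C]_n) : injective (frame H).
Proof. by move=> X Y eXY; rewrite -(frameK _ H X) eXY frameK. Qed.

Lemma frameM n (H X Y : 'M[C]_n) :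
  frame H (X *m Y) = frame H X *m frame H Y.
Proof.
by rewrite /frame !mulmxA -(mulmxA (spectralmx H *m X) (adj _)) mul_adj_spectralmx
  mulmx1.
Qed.

Lemma frame_trace n (H X : 'M[C]_n) : \tr (frame H X) = \tr X.
Proof. by rewrite /frame mxtrace_mulC mulmxA mul_adj_spectralmx mul1mx. Qed.

Lemma psd_frame n (H X : 'M[C]_n) : psd (frame H X) -> psd X.
Proof. by move=> X0; rewrite -(frameK _ H X); exact: psd_conj. Qed.

Lemma frame_trace_mul n (H X Y : 'M[C]_n) :
  \tr (X *m Y) = \sum_i \sum_j frame H X i j * frame H Y j i.
Proof.
by rewrite -(frame_trace _ H) frameM; apply: eq_bigr => i _; rewrite mxE.
Qed.

Lemma frame_spectral n (H D : 'M[C]_n) :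
  frame H (invmx (spectralmx H) *m D *m spectralmx H) = D.
Proof.
rewrite invmx_spectralmx /frame !mulmxA mul_spectralmx_adj mul1mx.
by rewrite -mulmxA mul_spectralmx_adj mulmx1.
Qed.

Lemma frame_fun_mx n (f : R -> C) (H : 'M[C]_n) :
  frame H (fun_mx f H) = diag_mx (\row_i f (complex.Re (eigs H 0 i))).
Proof. exact: frame_spectral. Qed.

Lemma frame_eigproj n (H : 'M[C]_n) a :
  frame H (eigproj H a) = diag_mx (\row_i (eigs H 0 i == a)%:R).
Proof. exact: frame_spectral. Qed.

Lemma frame_sum n (H : 'M[C]_n) (I : Type) (s : seq I) (F : I -> 'M[C]_n) :
  frame H (\sum_(i <- s) F i) = \sum_(i <- s) frame H (F i).
Proof. by rewrite /frame mulmx_sumr mulmx_suml. Qed.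

Lemma frameB n (H X Y : 'M[C]_n) :
  frame H (X - Y) = frame H X - frame H Y.
Proof. by rewrite /frame mulmxBr mulmxBl. Qed.

Lemma frameZ n (H X : 'M[C]_n) a : frame H (a *: X) = a *: frame H X.
Proof. by rewrite /frame -scalemxAr -scalemxAl. Qed.

Lemma frame1 n (H : 'M[C]_n) : frame H 1%:M = 1%:M.
Proof. by rewrite /frame mulmx1 mul_spectralmx_adj. Qed.

(** The eigenbasis that [spectralmx] returns for a diagonal matrix is not assumed to be the standard
    one. The relation [UH] forces [U i j] to vanish unless the i-th eigenvalue equals the j-th
    diagonal entry, so the same relation holds after applying [f]. *)
Lemma fun_mx_diag n (f : R -> C) (d : 'rV[R]_n) :
  fun_mx f (diag_mx (map_mx (real_complex R) d)) =
  diag_mx (\row_i f (d 0 i)).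
Proof.
set H := diag_mx _; set U := spectralmx H.
have hH : adj H = H.
  rewrite /H adj_diag; congr diag_mx; apply/rowP => i.
  by rewrite !mxE conjc_real.
have UH : U *m H = diag_mx (eigs H) *m U.
  by rewrite -(spectral_diagE _ _ hH) -[RHS]mulmxA mul_adj_spectralmx mulmx1.
apply: (frame_inj _ H); rewrite frame_fun_mx /frame.
suff -> : spectralmx H *m diag_mx (\row_i f (d 0 i)) =
    diag_mx (\row_i f (complex.Re (eigs H 0 i))) *m spectralmx H.
  by rewrite -mulmxA mul_spectralmx_adj mulmx1.
apply/matrixP => i j; move/matrixP/(_ i j): UH.
rewrite !mul_mx_diag !mul_diag_mx !mxE -/U; have [->|Uij] := eqVneq (U i j) 0.
  by rewrite !mulr0 !mul0r.
by rewrite mulrC => /(mulIf Uij) <-; rewrite mulrC.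
Qed.

Lemma frame_pinching n (H X : 'M[C]_n) i j :
  frame H (pinching H X) i j =
  if eigs H 0 i == eigs H 0 j then frame H X i j else 0.
Proof.
rewrite /pinching frame_sum summxE.
transitivity (\sum_(a <- undup [seq eigs H 0 i | i <- enum 'I_n])
  if a == eigs H 0 i then
    if eigs H 0 i == eigs H 0 j then frame H X i j else 0 else 0).
  apply: eq_bigr => a _.
  rewrite 2!frameM frame_eigproj mul_diag_mx mul_mx_diag !mxE.
  rewrite eq_sym; have [->|_] := eqVneq a; last by rewrite !mul0r.
  by rewrite mul1r eq_sym; case: eqVneq => _; rewrite ?(mulr1, mulr0).
(* Only the projector of the i-th eigenvalue can contribute to row i, and [undup] lists that
   eigenvalue exactly once. *)
have ai : eigs H 0 i \in undup [seq eigs H 0 i | i <- enum 'I_n].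
  by rewrite mem_undup; apply: map_f; rewrite mem_enum.
rewrite (bigD1_seq (eigs H 0 i)) ?undup_uniq //= eqxx big1 ?addr0 // => a.
by move=> /negPf ->.
Qed.

Lemma pinching_trace_mul n (H X Y : 'M[C]_n) :
  \tr (X *m pinching H Y) = \tr (pinching H X *m Y).
Proof.
rewrite !(frame_trace_mul _ H); apply: eq_bigr => i _; apply: eq_bigr => j _.
rewrite (frame_pinching _ H X) (frame_pinching _ H Y) eq_sym.
by case: eqP; rewrite ?(mulr0, mul0r).
Qed.

Lemma pinching_id n (H X : 'M[C]_n) :
  (forall i j, eigs H 0 i != eigs H 0 j -> frame H X i j = 0) ->
  pinching H X = X.
Proof.
move=> X0; apply: (frame_inj _ H); apply/matrixP => i j.
by rewrite frame_pinching; case: eqVneq => // /X0 ->.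
Qed.

Lemma pinching_idem n (H X : 'M[C]_n) :
  pinching H (pinching H X) = pinching H X.
Proof. by apply: pinching_id => i j /negPf ij; rewrite frame_pinching ij. Qed.

Lemma pinching1 n (H : 'M[C]_n) : pinching H 1%:M = 1%:M.
Proof.
apply: pinching_id => i j eij; rewrite frame1 mxE.
by have [ij|//] := eqVneq i j; rewrite ij eqxx in eij.
Qed.

Lemma pinchingB n (H X Y : 'M[C]_n) :
  pinching H (X - Y) = pinching H X - pinching H Y.
Proof.
apply: (frame_inj _ H); apply/matrixP => i j.
rewrite (frame_pinching _ H (X - Y)) (frameB _ H X) addmxE oppmxE.
rewrite (frameB _ H (pinching H X)) addmxE oppmxE.
rewrite (frame_pinching _ H X) (frame_pinching _ H Y).
by case: eqP; rewrite ?subr0.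
Qed.

Lemma adj_eigproj n (H : 'M[C]_n) a : adj (eigproj H a) = eigproj H a.
Proof.
rewrite /eigproj invmx_spectralmx !adjmxM adjmxK adj_diag mulmxA.
rewrite (_ : map_mx _ _ = \row_i (eigs H 0 i == a)%:R) //; apply/rowP => i.
by rewrite !mxE; case: eqP => _; rewrite ?(conjc0, conjc1).
Qed.

Lemma psd0 n : psd (0 : 'M[C]_n).
Proof. by move=> v; rewrite mulmx0 mul0mx mxE. Qed.

Lemma psd_pinching n (H X : 'M[C]_n) : psd X -> psd (pinching H X).
Proof.
move=> X0; apply: (big_ind (fun M => psd M)); first exact: psd0; first exact: psdD.
by move=> a _; rewrite -{1}adj_eigproj; exact: psd_conj.
Qed.

Lemma pinching_trace n (H X : 'M[C]_n) : \tr (pinching H X) = \tr X.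
Proof. by rewrite -[pinching _ _]mul1mx pinching_trace_mul pinching1 mul1mx. Qed.

(** The number e^{-i x t}, written in coordinates. *)
Definition phase (x t : R) : C := cos (x * t) +i* (- sin (x * t)).

Lemma phaseM x y t : phase x t * phase y (- t) = phase (x - y) t.
Proof.
rewrite /phase mulrN mulrBl cosB sinB cosN sinN.
by apply/eqP; rewrite eq_complex /=; apply/andP; split; apply/eqP; ring.
Qed.

Lemma phase0 t : phase 0 t = 1.
Proof. by rewrite /phase mul0r cos0 sin0 oppr0. Qed.

Lemma phase_pi x : x != 0 -> phase x (pi / x) = -1.
Proof.
move=> x0; rewrite /phase mulrC divfK // cospi sinpi oppr0.
by rewrite -[RHS]/(_ +i* _) oppr0.
Qed.

Lemma frame_evo n (H X : 'M[C]_n) t i j :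
  frame H (evo H t *m X *m evo H (- t)) i j =
  phase (complex.Re (eigs H 0 i) - complex.Re (eigs H 0 j)) t * frame H X i j.
Proof.
have fE u : frame H (evo H u) =
    diag_mx (\row_i phase (complex.Re (eigs H 0 i)) u) by exact: frame_fun_mx.
rewrite (frameM _ H (evo H t *m X)) (frameM _ H (evo H t)) !fE.
move: (frame H X) => Y; rewrite mul_diag_mx mul_mx_diag -phaseM !mxE; ring.
Qed.

Lemma pinching_evo_trace n (H X Y : 'M[C]_n) t :
  \tr (pinching H X *m (evo H t *m Y *m evo H (- t))) = \tr (pinching H X *m Y).
Proof.
rewrite !(frame_trace_mul _ H); apply: eq_bigr => i _; apply: eq_bigr => j _.
rewrite frame_evo frame_pinching; case: eqVneq => [->|_]; last by rewrite !mul0r.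
by rewrite subrr phase0 mul1r.
Qed.

(** An entry between levels with gap x is multiplied by -1 at time pi / x. Invariance then makes it
    equal to its own negative, hence zero. *)
Lemma evo_invariant_pinching n (H X : 'M[C]_n) : adj H = H ->
  (forall t (v : 'cV[C]_n),
    \tr (X *m (evo H t *m (v *m adj v) *m evo H (- t))) =
    \tr (X *m (v *m adj v))) ->
  pinching H X = X.
Proof.
move=> hH XH; apply: pinching_id => i j lij.
set x := complex.Re (eigs H 0 j) - complex.Re (eigs H 0 i).
(* Evolution sees only real parts of eigenvalues, whereas pinching compares the complex eigenvalues;
   they agree because [H] is Hermitian. *)
have x0 : x != 0.
  rewrite /x subr_eq0; apply: contra lij => /eqP lij.
  by rewrite (hermitian_eigs_real _ _ i hH) (hermitian_eigs_real _ _ j hH) lij.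
(* Cyclicity of the trace moves the evolution from the rank-one matrix to [X], with reversed
   time. *)
have : evo H (- (pi / x)) *m X *m evo H (- - (pi / x)) - X = 0.
  apply: quad_form_eq0 => v.
  rewrite quad_form_trace mulmxBl linearB /= -(XH (pi / x)) opprK; apply/eqP.
  rewrite subr_eq0 -2!(mulmxA (evo H (- (pi / x)))) mxtrace_mulC; apply/eqP.
  by rewrite !mulmxA.
move/(congr1 (frame H))/matrixP/(_ i j).
rewrite frameB addmxE oppmxE frame_evo.
have -> : phase (complex.Re (eigs H 0 i) - complex.Re (eigs H 0 j)) (- (pi / x))
    = -1.
  rewrite -(phase_pi x x0) /phase /x; congr (cos _ +i* (- sin _)); ring.
rewrite [frame H 0]/frame mulmx0 mul0mx [RHS]mxE mulN1r -opprD => /eqP.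
by rewrite oppr_eq0 -mulr2n mulrn_eq0 /= => /eqP.
Qed.

(** * Spectral form of the Gibbs state *)

Section Gibbs.
Variables (beta : R) (n : nat) (H : 'M[C]_n).
Hypothesis n_gt0 : (0 < n)%N.

Let boltzmann i := expR (- (beta * complex.Re (eigs H 0 i))).
Let Z := \sum_i boltzmann i.

Let Z_gt0 : 0 < Z.
Proof.
rewrite /Z (bigD1 (Ordinal n_gt0)) //= ltr_wpDr ?expR_gt0 //.
by apply: sumr_ge0 => i _; exact: expR_ge0.
Qed.

Let frame_expm : frame H (expm_neg beta H) = diag_mx (\row_i (boltzmann i)%:C).
Proof. exact: frame_fun_mx. Qed.

Let trace_expm : \tr (expm_neg beta H) = Z%:C.
Proof.
rewrite -(frame_trace _ H) frame_expm mxtrace_diag /Z rmorph_sum /=.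
by apply: eq_bigr => i _; rewrite mxE.
Qed.

Let frame_gibbs :
  frame H (gibbs beta H) = diag_mx (\row_i (boltzmann i / Z)%:C).
Proof.
rewrite /gibbs frameZ frame_expm trace_expm; apply/matrixP => i j.
rewrite !mxE; case: eqVneq => [->|_]; last by rewrite !mulr0n mulr0.
by rewrite !mulr1n rmorphM fmorphV mulrC.
Qed.

Lemma gibbs_trace : \tr (gibbs beta H) = 1.
Proof.
rewrite /gibbs mxtraceZ trace_expm mulVf //.
by rewrite fmorph_eq0 gt_eqF.
Qed.

Lemma gibbs_psd : psd (gibbs beta H).
Proof.
apply: (psd_frame _ H); rewrite frame_gibbs; apply: psd_diag => i.
by rewrite mxE ler0c divr_ge0 ?expR_ge0 ?ltW.
Qed.

(** Each Boltzmann weight is one nonnegative summand of the partition function, hence at most equal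
    to it. *)
Lemma gibbs_psdC : psd (1%:M - gibbs beta H).
Proof.
apply: (psd_frame _ H); rewrite frameB frame1 frame_gibbs -diag_const_mx.
rewrite -linearB /=; apply: psd_diag => i.
rewrite !mxE -(rmorph1 (real_complex R)) -rmorphB ler0c subr_ge0.
rewrite ler_pdivrMr // mul1r /Z (bigD1 i) //= lerDl.
by apply: sumr_ge0 => j _; exact: expR_ge0.
Qed.

Lemma pinching_gibbs : pinching H (gibbs beta H) = gibbs beta H.
Proof.
apply: pinching_id => i j; rewrite frame_gibbs !mxE.
by have [->|_ _] := eqVneq i j; rewrite ?eqxx ?mulr0n.
Qed.

End Gibbs.

End EnergyEigenbasis.

(** * Complete positivity, measure-and-prepare channels and the qubit trace norm *)

Section Channels.
Context {R : realType}.
Local Notation C := R[i].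

Lemma quad_form_mxblock k n (B : 'I_k -> 'I_k -> 'M[C]_n)
    (v : forall i : 'I_k, 'cV[C]_n) :
  (adj (\mxcol_i v i) *m (\mxblock_(i, j) B i j) *m \mxcol_i v i) ord0 ord0
  = \sum_i \sum_j (adj (v i) *m B i j *m v j) ord0 ord0.
Proof.
have -> : adj (\mxcol_i v i) = \mxrow_i adj (v i).
  by rewrite /adj tr_mxcol; apply/matrixP => i j; rewrite !mxE.
rewrite mul_mxrow_mxblock mul_mxrow_mxcol summxE exchange_big /=.
apply: eq_bigr => j _.
by rewrite mulmx_suml summxE.
Qed.

Lemma CP_positive n m (E : 'M[C]_n -> 'M[C]_m) A : is_CP E -> psd A -> psd (E A).
Proof.
move=> Ecp A0 v.
have B0 : psd (\mxblock_(i < 1, j < 1) A).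
  move=> w; rewrite -[w]submxcolK quad_form_mxblock !big_ord1; exact: A0.
have := Ecp 1%N (fun _ _ => A) B0 (\mxcol_i v).
by rewrite quad_form_mxblock !big_ord1.
Qed.

(** Complete positivity of X |-> Tr[L X]. With L = sum_l lambda_l w_l w_l^*, the l-th summand is
    lambda_l times the quadratic form of the block matrix at the stacked vector with blocks c_i
    w_l. *)
Lemma trace_psd_CP k n (L : 'M[C]_n) (B : 'I_k -> 'I_k -> 'M[C]_n)
    (c : 'I_k -> C) :
  psd L -> psd (\mxblock_(i < k, j < k) B i j) ->
  0 <= \sum_i \sum_j conjc (c i) * \tr (L *m B i j) * c j.
Proof.
move=> L0 B0.
pose w l : 'cV[C]_n := adj (spectralmx L) *m delta_mx l 0.
suff -> : \sum_i \sum_j conjc (c i) * \tr (L *m B i j) * c j =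
    \sum_l eigs L 0 l * (adj (\mxcol_i (c i *: w l)) *m
      (\mxblock_(i, j) B i j) *m \mxcol_i (c i *: w l)) ord0 ord0.
  by apply: sumr_ge0 => l _; rewrite mulr_ge0 ?psd_eigs_ge0.
under [RHS]eq_bigr do rewrite quad_form_mxblock mulr_sumr.
rewrite [RHS]exchange_big; apply: eq_bigr => i _ /=.
under [RHS]eq_bigr do rewrite mulr_sumr.
rewrite [RHS]exchange_big; apply: eq_bigr => j _ /=.
rewrite psd_trace_mulE // mulr_sumr mulr_suml; apply: eq_bigr => l _.
rewrite -/(w l) adjmxZ -!scalemxAl -!scalemxAr !scalemxE; ring.
Qed.

Definition measure_channel {n} (L X : 'M[C]_n) : 'M[C]_2 :=
  diag_mx (\row_(i < 2)
    (if i == 0 :> nat then \tr (L *m X) else \tr ((1%:M - L) *m X))).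

Lemma measure_channel_is_channel n (L : 'M[C]_n) :
  psd L -> psd (1%:M - L) -> is_channel (measure_channel L).
Proof.
move=> L0 L1; split; [|split].
- move=> a X Y; apply/matrixP => i j; rewrite !mxE.
  case: (eqVneq i j) => [_|_]; last by rewrite !mulr0n mulr0 addr0.
  by rewrite !mulr1n; case: ifP => _;
    rewrite mulmxDr -scalemxAr linearD linearZ.
- move=> k B B0 v; rewrite -[v]submxcolK quad_form_mxblock.
  set c := submxcol v; move: c => c.
  (* The output is diagonal, so the form splits into one sum per basis state, with the effects [L]
     and [1%:M - L]. *)
  have -> : \sum_i \sum_j
      (adj (c i) *m measure_channel L (B i j) *m c j) ord0 ord0 =
      \sum_i \sum_j conjc (c i 0 0) * \tr (L *m B i j) * c j 0 0 +
      \sum_i \sum_j conjc (c i 1 0) * \tr ((1%:M - L) *m B i j) * c j 1 0.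
    rewrite -big_split; apply: eq_bigr => i _; rewrite -big_split.
    apply: eq_bigr => j _ /=; rewrite mul_mx_diag mxE !big_ord_recl big_ord0.
    have -> : lift ord0 ord0 = 1 :> 'I_2 by apply/val_inj.
    by rewrite addr0 !mxE.
  by apply: addr_ge0; exact: trace_psd_CP.
- move=> X; rewrite mxtrace_diag !big_ord_recl big_ord0 addr0 !mxE /=.
  by rewrite -linearD /= -mulmxDl addrC subrK mul1mx.
Qed.

Lemma ord2P (i : 'I_2) : i = 0 \/ i = 1.
Proof.
by case: i => [[|[|//]] lt_i2]; [left|right]; apply/val_inj.
Qed.

(* Such an X satisfies X X^* = (a^2 + |b|^2) I, a = X 0 0 and b = X 0 1. *)
Lemma trnorm_traceless2 (X : 'M[C]_2) : adj X = X -> \tr X = 0 ->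
  trnorm X = 2 * Num.sqrt (complex.Re (X 0 0) ^+ 2 +
    (complex.Re (X 0 1) ^+ 2 + complex.Im (X 0 1) ^+ 2)).
Proof.
move=> hX trX; set r := (X in Num.sqrt X).
have X11 : X 1 1 = - X 0 0.
  apply/eqP; rewrite -addr_eq0 addrC -trX /mxtrace !big_ord_recl big_ord0 addr0.
  by apply/eqP; congr (_ + X _ _); apply/val_inj.
have X10 : X 1 0 = conjc (X 0 1) by rewrite -adjmxE hX.
have X00 : conjc (X 0 0) = X 0 0 by rewrite -adjmxE hX.
have XX : X *m adj X = (r%:C)%:M.
  apply/matrixP => i j; rewrite mxE !big_ord_recl big_ord0 addr0 !adjmxE.
  have -> : lift ord0 ord0 = 1 :> 'I_2 by apply/val_inj.
  rewrite mxE.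
  move: X00; rewrite /r; case: (ord2P i) => ->; case: (ord2P j) => ->;
  rewrite ?X11 ?X10 ?rmorphN ?conjcK;
  case: (X 0 0) => a a'; case: (X 0 1) => b b' [] a'N;
  (have {a'N} -> : a' = 0 by lra); rewrite /= ?mulr1n ?mulr0n;
  by apply/eqP; rewrite eq_complex /=; apply/andP; split; apply/eqP; ring.
have e i : eigs (X *m adj X) 0 i = r%:C.
  have hh : adj (X *m adj X) = X *m adj X by rewrite adjmxM adjmxK.
  have := spectral_diagE _ _ hh; rewrite {2}XX mul_mx_scalar -scalemxAl.
  rewrite mul_spectralmx_adj => /matrixP/(_ i i).
  by rewrite !mxE eqxx mulr1n mulr1.
have r0 : 0 <= r by rewrite /r !addr_ge0 ?sqr_ge0.
rewrite /trnorm; under eq_bigr do rewrite e.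
have -> : sqrtC r%:C = (Num.sqrt r)%:C.
  by rewrite -{1}(sqr_sqrtr r0) rmorphXn /= sqrCK // ler0c sqrtr_ge0.
by rewrite !big_ord_recl big_ord0 addr0 /=; ring.
Qed.

End Channels.

(** * Real trace pairing, kernel projectors and effects *)

Section RealTrace.
Context {R : realType}.
Local Notation C := R[i].

(** The trace pairing as a real number; nothing is lost for two positive semidefinite matrices,
    whose trace pairing is real. *)
Definition retr {n} (A B : 'M[C]_n) : R := complex.Re (\tr (A *m B)).

Lemma ReD (x y : C) : complex.Re (x + y) = complex.Re x + complex.Re y.
Proof. by case: x y => [a b] [c d]. Qed.

Lemma ReN (x : C) : complex.Re (- x) = - complex.Re x.
Proof. by case: x. Qed.

Lemma ReZ (k : R) (x : C) : complex.Re (k%:C * x) = k * complex.Re x.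
Proof. by case: x => a b /=; rewrite mul0r subr0. Qed.

Lemma retrC n (A B : 'M[C]_n) : retr A B = retr B A.
Proof. by rewrite /retr mxtrace_mulC. Qed.

Lemma retrDl n (A B X : 'M[C]_n) : retr (A + B) X = retr A X + retr B X.
Proof. by rewrite /retr mulmxDl linearD ReD. Qed.

Lemma retrBl n (A B X : 'M[C]_n) : retr (A - B) X = retr A X - retr B X.
Proof. by rewrite /retr mulmxBl linearB /= ReD ReN. Qed.

Lemma retrZl n k (A X : 'M[C]_n) : retr (k%:C *: A) X = k * retr A X.
Proof. by rewrite /retr -scalemxAl linearZ /= ReZ. Qed.

Lemma retr1l n (X : 'M[C]_n) : retr 1%:M X = complex.Re (\tr X).
Proof. by rewrite /retr mul1mx. Qed.

Lemma retr_ge0 n (A B : 'M[C]_n) : psd A -> psd B -> 0 <= retr A B.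
Proof.
move=> A0 B0; have := psd_trace_mul_ge0 _ _ _ A0 B0.
by rewrite lecE => /andP[].
Qed.

Lemma trace_psd_retr n (A B : 'M[C]_n) : psd A -> psd B ->
  \tr (A *m B) = (retr A B)%:C.
Proof.
move=> A0 B0; have := psd_trace_mul_ge0 _ _ _ A0 B0.
rewrite /retr; case: (\tr _) => a b; rewrite lecE /= => /andP[/eqP -> _].
by [].
Qed.

(** The support projector of [S] is at most [K *: S] once [K] dominates the inverse of every nonzero
    eigenvalue. *)
Lemma retr_kernel_bound n (S : 'M[C]_n) : psd S ->
  exists2 K : R, 0 <= K &
    forall M, psd M -> retr (1%:M - eigproj S 0) M <= K * retr S M.
Proof.
move=> S0; pose s i := complex.Re (eigs S 0 i).
have sE i : eigs S 0 i = (s i)%:C.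
  exact/hermitian_eigs_real/psd_hermitian.
have s0 i : 0 <= s i by rewrite -ler0c -sE psd_eigs_ge0.
have sV i : 0 <= (s i)^-1 by rewrite invr_ge0.
(* Zero eigenvalues contribute nothing, since the inverse of 0 is 0. *)
pose K := \sum_i (s i)^-1; exists K; first exact: sumr_ge0.
move=> M M0; rewrite -subr_ge0 -retrZl -retrBl; apply: retr_ge0 => //.
apply: (psd_frame _ S); rewrite !frameB frameZ frame1 frame_eigproj.
have -> : frame S S = diag_mx (eigs S) by exact/spectral_diagE/psd_hermitian.
rewrite -diag_const_mx -linearZ -!linearB /=; apply: psd_diag => i.
rewrite !mxE sE; have [/eqP|si] := eqVneq (s i)%:C 0.
  by rewrite fmorph_eq0 => /eqP ->; rewrite mulr0 !subrr.
rewrite subr0 -rmorphM -(rmorph1 (real_complex R)) -rmorphB ler0c subr_ge0.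
rewrite fmorph_eq0 in si.
rewrite -(@mulVf _ (s i)) // ler_wpM2r // /K (bigD1 i) //= lerDl.
exact: sumr_ge0.
Qed.

Lemma eigproj_idem n (S : 'M[C]_n) a :
  eigproj S a *m eigproj S a = eigproj S a.
Proof.
apply: (frame_inj _ S); rewrite frameM frame_eigproj mul_diag_mx.
apply/matrixP => i j; rewrite !mxE.
by case: eqP; rewrite ?(mul1r, mul0r, mul0rn).
Qed.

Lemma eigproj0_mul n (S : 'M[C]_n) : adj S = S -> eigproj S 0 *m S = 0.
Proof.
move=> hS; apply: (frame_inj _ S); rewrite frameM frame_eigproj.
have -> : frame S S = diag_mx (eigs S) by exact: spectral_diagE.
rewrite mul_diag_mx [frame S 0]/frame.
rewrite mulmx0 mul0mx; apply/matrixP => i j; rewrite !mxE.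
by case: eqP => [->|_]; rewrite ?(mul0rn, mulr0, mul0r).
Qed.

Definition effect {n} (L : 'M[C]_n) := psd L /\ psd (1%:M - L).

Lemma effect_mix n (L : 'M[C]_n) (s : R) : 0 <= s <= 1 -> effect L ->
  effect ((1 - s)%:C *: L + s%:C *: 1%:M).
Proof.
move=> /andP[s0 s1] [L0 L1]; split.
  apply: psdD; apply: psdZ; rewrite ?ler0c ?subr_ge0; [exact: s1|exact: L0| |].
    exact: s0.
  exact: psd1.
have -> : 1%:M - ((1 - s)%:C *: L + s%:C *: 1%:M) = (1 - s)%:C *: (1%:M - L).
  by apply/matrixP => i j; rewrite !mxE rmorphB rmorph1; ring.
by apply: psdZ; rewrite ?ler0c ?subr_ge0.
Qed.

(* The matrix is Y M Y with Y = r D - r^-1 (1 - D). *)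
Lemma psd_two_block_bound n (M D : 'M[C]_n) (r : R) :
  r != 0 -> psd M -> adj D = D ->
  let D' := 1%:M - D in
  psd ((1 + r ^+ 2)%:C *: (D *m M *m D) +
       (1 + r ^- 2)%:C *: (D' *m M *m D') - M).
Proof.
move=> r0 M0 hD D'.
pose Y := r%:C *: D - r^-1%:C *: D'.
have hY : adj Y = Y by rewrite /Y /D' adjmxB !adjmxZ adjmxB adjmx1 hD !conjc_real.
suff -> : (1 + r ^+ 2)%:C *: (D *m M *m D) +
       (1 + r ^- 2)%:C *: (D' *m M *m D') - M = adj Y *m M *m Y.
  exact: psd_conj.
have MD : M = D *m M *m D + D *m M *m D' + D' *m M *m D + D' *m M *m D'.
  rewrite -addrA -!mulmxDr -!mulmxDl -/D'.
  by rewrite /D' ![D + _]addrC !subrK mulmx1 mul1mx.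
have -> : adj Y *m M *m Y = (r ^+ 2)%:C *: (D *m M *m D) - D *m M *m D' -
    D' *m M *m D + (r ^- 2)%:C *: (D' *m M *m D').
  rewrite hY /Y; clear MD hY Y; move: D' => E.
  rewrite mulmxBr !mulmxBl -!scalemxAr -!scalemxAl ?scalerBr !scalerA.
  rewrite -!rmorphM mulfV // mulVf // rmorph1 !scale1r -!expr2 exprVn.
  by rewrite opprB addrA addrAC [in RHS](addrAC (_ *: _)).
rewrite {3}MD; move: (D *m M *m D) (D *m M *m D') (D' *m M *m D)
  (D' *m M *m D') => P1 P2 P3 P4.
apply/matrixP => i j; rewrite !mxE !rmorphD rmorph1; ring.
Qed.

End RealTrace.

(** * Removing an arbitrarily small excess error from a test *)

Section HypothesisTesting.
Context {R : realType}.
Local Notation C := R[i].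

Lemma retr_state1 n (S : 'M[C]_n) : \tr S = 1 -> retr 1%:M S = 1.
Proof. by rewrite retr1l => ->. Qed.

Lemma effect_retr_le1 n (L S : 'M[C]_n) :
  effect L -> psd S -> \tr S = 1 -> retr L S <= 1.
Proof.
move=> [_ L1] S0 S1; rewrite -subr_ge0 -(retr_state1 _ _ S1) -retrBl.
exact: (retr_ge0 _ _ _ L1 S0).
Qed.

Section Limit.
Variables (n : nat) (S G : 'M[C]_n) (c : R).
Hypotheses (S0 : psd S) (S1 : \tr S = 1).
Hypotheses (G0 : psd G) (G1 : \tr G = 1) (GC : psd (1%:M - G)).

(** Mixing with the identity shrinks the whole error by the factor 1 - s. The excess eps * eta and s
    = eta / (1 + eta) are matched: (1 - s)(eps + eps * eta) = eps exactly, while the value on [G]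
    grows by at most s <= eta. *)
Lemma effect_limit_pos eps : 0 < eps ->
  (forall d : R, 0 < d -> exists2 L, effect L &
     retr L G = c /\ 1 - (eps + d) <= retr L S) ->
  forall eta : R, 0 < eta -> exists2 L, effect L &
     1 - eps <= retr L S /\ retr L G <= c + eta.
Proof.
move=> eps0 near eta eta0.
have [L eL [LG LS]] := near (eps * eta) (mulr_gt0 eps0 eta0).
have e1 : 0 < 1 + eta by rewrite addr_gt0.
pose s := eta / (1 + eta).
have s0 : 0 <= s by rewrite divr_ge0 ?ltW.
have s1E : 1 - s = (1 + eta)^-1.
  by rewrite /s -{1}(mulfV (lt0r_neq0 e1)) -mulrBl addrK mul1r.
have s1 : s <= 1 by rewrite -subr_ge0 s1E invr_ge0 ltW.
exists ((1 - s)%:C *: L + s%:C *: 1%:M).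
  by apply: effect_mix; rewrite ?s0.
rewrite !retrDl !retrZl !retr_state1 // LG !mulr1; split.
  have : (1 - s) * (1 - (eps + eps * eta)) <= (1 - s) * retr L S.
    by rewrite ler_wpM2l // subr_ge0.
  have -> : (1 - s) * (1 - (eps + eps * eta)) = 1 - s - eps.
    rewrite s1E; field; exact: lt0r_neq0.
  lra.
have c0 : 0 <= c by rewrite -LG; case: eL => L0 _; exact: retr_ge0.
have : s <= eta by rewrite ler_pdivrMr // mulrDr mulr1 lerDl mulr_ge0 ?ltW.
have : 0 <= s * c by rewrite mulr_ge0.
lra.
Qed.

(* On the support of S the defect M = 1 - L of a nearly perfect test is small,
   and cutting it down to the kernel of S makes the test perfect. *)
Lemma effect_limit_zero :
  (forall d : R, 0 < d -> exists2 L, effect L &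
     retr L G = c /\ 1 - d <= retr L S) ->
  forall eta : R, 0 < eta -> exists2 L, effect L &
     1 <= retr L S /\ retr L G <= c + eta.
Proof.
move=> near eta eta0.
have [K K0 KS] := retr_kernel_bound n S S0.
(* The budget [eta] is halved. The choice of [r] makes the r^2 term of the two-block bound at most
   eta / 2; [q] fixes the accuracy of the test so that the term with 1 + r^-2 is also at most eta /
   2. Using K + 1 keeps [q] positive without knowing K > 0. *)
pose r := Num.min 1 (eta / 2).
have r0 : 0 < r by rewrite lt_min ltr01 divr_gt0.
have rr : r ^+ 2 <= eta / 2.
  apply: (le_trans (y := r)); last by rewrite ge_min lexx orbT.
  by rewrite expr2 ler_piMr ?(ltW r0) // ge_min lexx.
pose q := (1 + r ^- 2) * (K + 1).
have rV0 : 0 < r ^- 2 by rewrite invr_gt0 exprn_gt0.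
have K1 : 0 < K + 1 by rewrite ltr_wpDl.
have q0 : 0 < q by rewrite mulr_gt0 // addr_gt0.
have [L [L0 L1] [LG LS]] := near (eta / 2 / q) (divr_gt0 (divr_gt0 eta0 (ltr0Sn _ 1)) q0).
set M := 1%:M - L in L1.
pose D := eigproj S 0; pose D' := 1%:M - D.
have hD : adj D = D by exact: adj_eigproj.
have DD : D *m D = D by exact: eigproj_idem.
have DS : D *m S = 0 by exact/eigproj0_mul/psd_hermitian.
have hD' : adj D' = D' by rewrite /D' adjmxB adjmx1 hD.
have DD' : D' *m D' = D'.
  by rewrite /D' mulmxBr mulmx1 mulmxBl mul1mx DD subrr subr0.
have pM' : psd (D *m M *m D) by rewrite -{1}hD; exact: psd_conj.
have pL' : psd (1%:M - D *m M *m D).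
  (* Since M = 1 - L and D is a projector, the compressed test is D' plus the compression of L, a
     sum of positive matrices. *)
  have -> : 1%:M - D *m M *m D = D' + D *m L *m D.
    by rewrite /M mulmxBr mulmx1 mulmxBl DD /D' opprB addrA addrAC.
  apply: psdD.
    by rewrite -DD' -{1}hD' -[adj D']mulmx1; exact/psd_conj/psd1.
  by rewrite -{1}hD; exact: psd_conj.
have MG : retr M G = 1 - c by rewrite retrBl retr_state1 // LG.
have MS : retr S M <= eta / 2 / q.
  by rewrite retrC retrBl retr_state1 //; move: LS; lra.
exists (1%:M - D *m M *m D).
  split; first exact: pL'.
  by rewrite opprB addrCA subrr addr0; exact: pM'.
rewrite !retrBl !retr_state1 //; split.
  by rewrite {1}/retr -mulmxA DS mulmx0 mxtrace0 subr0.
have := retr_ge0 _ _ _ (psd_two_block_bound _ _ _ r (lt0r_neq0 r0) L1 hD) G0.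
rewrite -/D' retrBl retrDl !retrZl MG => bound.
(* Since G <= 1, the value on [G] is at most Tr[D' M D'] = Tr[D' M], which the kernel bound controls
   by Tr[S M]. *)
have D'M : retr (D' *m M *m D') G <= K * (eta / 2 / q).
  apply: (le_trans (y := retr D' M)); last first.
    by apply: (le_trans (KS M L1)); rewrite ler_wpM2l.
  have : 0 <= retr (1%:M - G) (D' *m M *m D').
    apply: retr_ge0; first exact: GC.
    by rewrite -{1}hD'; exact: psd_conj.
  rewrite retrBl retr1l mxtrace_mulC mulmxA DD' -/(retr D' M) (retrC _ G).
  by rewrite subr_ge0.
have T1 : retr (D *m M *m D) G <= 1.
  by rewrite -subr_ge0 -(retr_state1 _ _ G1) -retrBl retr_ge0.
have B1 : (1 + r ^- 2) * retr (D' *m M *m D') G <= eta / 2.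
  apply: (le_trans (y := (1 + r ^- 2) * (K * (eta / 2 / q)))).
    by rewrite ler_wpM2l // addr_ge0 // ltW.
  rewrite -[X in _ <= X](divfK (lt0r_neq0 q0)) mulrCA mulrA mulrC.
  rewrite ler_wpM2l ?divr_ge0 ?(ltW eta0) ?(ltW q0) //.
  by rewrite /q mulrC ler_wpM2l ?lerDl // addr_ge0 // ltW.
have B2 : r ^+ 2 * retr (D *m M *m D) G <= eta / 2.
  by apply: le_trans rr; rewrite ler_piMr // sqr_ge0.
move: bound B1 B2; rewrite mulrDl mul1r.
move: (retr (D *m M *m D) G) ((1 + r ^- 2) * _) (r ^+ 2 * _) => x y z; lra.
Qed.

Lemma effect_limit eps : 0 <= eps ->
  (forall d : R, 0 < d -> exists2 L, effect L &
     retr L G = c /\ 1 - (eps + d) <= retr L S) ->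
  forall eta : R, 0 < eta -> exists2 L, effect L &
     1 - eps <= retr L S /\ retr L G <= c + eta.
Proof.
rewrite le_eqVlt => /orP[/eqP <- near|]; last exact: effect_limit_pos.
rewrite subr0; apply: effect_limit_zero => d /near.
by rewrite add0r.
Qed.

End Limit.

End HypothesisTesting.

(** * Translation between covariant channels into the qubit and effects *)

Section Distillation.
Context {R : realType}.
Local Notation C := R[i].

Lemma evo_diag n (d : 'rV[R]_n) t :
  evo (diag_mx (map_mx (real_complex R) d)) t =
  diag_mx (\row_i phase (d 0 i) t).
Proof. exact: fun_mx_diag. Qed.

Definition qubit_energy (beta m : R) : 'rV[R]_2 :=
  \row_(i < 2) (if i == 0 :> nat then 0 else - (ln (m - 1) / beta)).

Lemma H_XE (beta m : R) :
  H_X beta m = diag_mx (map_mx (real_complex R) (qubit_energy beta m)).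
Proof. by congr diag_mx; apply/rowP => i; rewrite !mxE. Qed.

Lemma qubit_evoE (beta m t : R) (Y : 'M[C]_2) i j :
  let h := qubit_energy beta m in
  (evo (H_X beta m) t *m Y *m evo (H_X beta m) (- t)) i j =
  phase (h 0 i - h 0 j) t * Y i j.
Proof.
move=> h; rewrite H_XE !evo_diag mul_diag_mx mul_mx_diag -phaseM.
rewrite mxE [in X in X * _]mxE ![(\row__ _) _ _]mxE; ring.
Qed.

Lemma is_linear_sum n m (E : 'M[C]_n -> 'M[C]_m) (I : Type) (s : seq I)
    (a : I -> C) (F : I -> 'M[C]_n) :
  is_linear E -> E (\sum_(i <- s) a i *: F i) = \sum_(i <- s) a i *: E (F i).
Proof.
move=> El; elim: s => [|i s IHs]; last by rewrite !big_cons El IHs.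
rewrite !big_nil; have := El 1 0 0; rewrite !scale1r addr0 => /eqP.
by rewrite -subr_eq0 opprD addrA subrr sub0r oppr_eq0 => /eqP.
Qed.

(** The matrix of E^dagger(|0><0|). The indices are swapped because Tr[L e_j e_i^*] = L_ij. *)
Definition ground_effect {n} (E : 'M[C]_n -> 'M[C]_2) : 'M[C]_n :=
  \matrix_(i, j) E (delta_mx j i) 0 0.

Lemma ground_effectE n (E : 'M[C]_n -> 'M[C]_2) X : is_linear E ->
  \tr (ground_effect E *m X) = E X 0 0.
Proof.
move=> El; rewrite [in RHS](matrix_sum_delta X) pair_big /=.
rewrite (is_linear_sum _ _ E _ _ (fun p => X p.1 p.2)
  (fun p => delta_mx p.1 p.2)) // summxE -(pair_big xpredT xpredT
  (fun i j => (X i j *: E (delta_mx i j)) 0 0)) /= exchange_big /=.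
apply: eq_bigr => i _; rewrite mxE; apply: eq_bigr => j _.
by rewrite !mxE mulrC.
Qed.

Lemma ground_effectP n (E : 'M[C]_n -> 'M[C]_2) : is_channel E ->
  effect (ground_effect E).
Proof.
move=> [El [Ecp Etp]]; split=> v.
  rewrite quad_form_trace ground_effectE //.
  exact/psd_diag_ge0/CP_positive/psd_rank1.
rewrite quad_form_trace mulmxBl mul1mx linearB /= ground_effectE // -Etp.
rewrite /mxtrace !big_ord_recl big_ord0 addr0 [X in X - _]addrC addrK.
exact/psd_diag_ge0/CP_positive/psd_rank1.
Qed.

(** Covariance is assumed on states only; normalizing by the trace carries it to every v v^*. *)
Lemma rank1_state n (v : 'cV[C]_n) : v = 0 \/
  exists2 c : C, c != 0 & is_state (c *: (v *m adj v)).
Proof.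
pose N := \tr (v *m adj v).
have N0 : 0 <= N by exact/psd_trace_ge0/psd_rank1.
have [NE|Nn0] := eqVneq N 0; [left|right].
  apply/matrixP => i j; rewrite ord1 mxE; apply/eqP; rewrite -normr_eq0.
  have := NE; rewrite /N /mxtrace => /eqP.
  rewrite psumr_eq0 => [/allP/(_ i)|k _]; last first.
    exact/psd_diag_ge0/psd_rank1.
  rewrite mem_index_enum => /(_ isT) /=.
  rewrite mxE big_ord1 adjmxE mulf_eq0 conjc_eq0 orbb => /eqP ->.
  by rewrite normr0.
exists N^-1; first by rewrite invr_eq0.
split; first by apply: psdZ; [rewrite invr_ge0|exact: psd_rank1].
by rewrite mxtraceZ mulVf.
Qed.

(** Qubit evolution leaves diagonal entries unchanged whatever the two energies are, so covariance
    makes the effect invariant under evolution on the input side. *)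
Lemma ground_effect_pinching (beta m : R) n (H G : 'M[C]_n) E :
  adj H = H -> GPC H G (H_X beta m) (u_m m) E ->
  pinching H (ground_effect E) = ground_effect E.
Proof.
move=> hH [[El _] [_ Ecov]]; apply: evo_invariant_pinching => // t v.
have [->|[c c0 wS]] := rank1_state _ v.
  by rewrite mul0mx !(mulmx0, mul0mx).
apply: (mulfI c0); rewrite -!mxtraceZ !(scalemxAr c (ground_effect E)).
rewrite scalemxAl (scalemxAr c (evo H t)).
by rewrite !ground_effectE // Ecov // qubit_evoE subrr phase0 mul1r.
Qed.

Lemma ket0proj_psd : psd (ket0proj R).
Proof. by apply: psd_diag => i; rewrite mxE ler0n. Qed.

Lemma trnorm_ket0_sub (T : 'M[C]_2) : adj T = T -> \tr T = 1 ->
  trnorm (ket0proj R - T) = 2 * Num.sqrt ((1 - complex.Re (T 0 0)) ^+ 2 +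
    (complex.Re (T 0 1) ^+ 2 + complex.Im (T 0 1) ^+ 2)).
Proof.
move=> hT T1; rewrite trnorm_traceless2.
- rewrite !addmxE !oppmxE !mxE /= mulr1n mulr0n !ReD !ReN.
  by case: (T 0 1) => a b /=; rewrite !sub0r !sqrrN.
- by rewrite adjmxB hT psd_hermitian //; exact: ket0proj_psd.
- rewrite linearB /= T1 mxtrace_diag !big_ord_recl big_ord0 !mxE /=.
  by rewrite !addr0 subrr.
Qed.

Lemma GPC_effect (beta m : R) n (H G rho : 'M[C]_n) E :
  adj H = H -> is_state rho -> GPC H G (H_X beta m) (u_m m) E ->
  exists2 L, effect L & retr L G = m^-1 /\
    1 - trnorm (ket0proj R - E rho) / 2 <= retr L (pinching H rho).
Proof.
move=> hH [rho0 rho1] gE; have [[El [Ecp Etp]] [EG _]] := gE.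
exists (ground_effect E); first by apply: ground_effectP.
have El' : forall X, retr (ground_effect E) X = complex.Re (E X 0 0).
  by move=> X; rewrite /retr ground_effectE.
split; first by rewrite El' EG !mxE.
rewrite /retr pinching_trace_mul (ground_effect_pinching _ _ _ _ _ _ hH gE).
rewrite -/(retr _ _) El' trnorm_ket0_sub ?Etp //; last first.
  exact/psd_hermitian/CP_positive.
rewrite mulrC mulKf ?pnatr_eq0 // lerBlDr addrC -lerBlDr.
(* Dropping the coherence term under the root leaves |1 - T_00|, with T = E(rho). *)
apply: le_trans (ler_norm _) _; rewrite -sqrtr_sqr ler_wsqrtr //.
by rewrite lerDl addr_ge0 ?sqr_ge0.
Qed.

(** The channel measures the pinched effect: this keeps the value on the Gibbs state, which pinching
    fixes, and moves the pinching from the effect to [rho]. The output is diagonal, so covariance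
    holds for every choice of qubit energies, including the convention at m = 1. *)
Lemma effect_GPC (beta : R) n (H rho : 'M[C]_n) L :
  (0 < n)%N -> is_state rho -> effect L ->
  let q := retr L (gibbs beta H) in
  0 < q ->
  exists2 E, GPC H (gibbs beta H) (H_X beta q^-1) (u_m q^-1) E &
    trnorm (ket0proj R - E rho) / 2 = 1 - retr L (pinching H rho).
Proof.
move=> n0 [rho0 rho1] [L0 L1] q q0.
pose P := pinching H L.
have P0 : psd P by exact: psd_pinching.
have pR0 : psd (pinching H rho) by exact: psd_pinching.
have P1 : psd (1%:M - P) by rewrite -(pinching1 _ H) -pinchingB; exact: psd_pinching.
have PC : 1%:M - P = pinching H (1%:M - P).
  by rewrite pinchingB pinching1 /P pinching_idem.
have G0 := gibbs_psd beta n H n0.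
have chE := measure_channel_is_channel _ _ P0 P1.
have PG : \tr (P *m gibbs beta H) = q%:C.
  by rewrite /P -pinching_trace_mul pinching_gibbs // trace_psd_retr.
exists (measure_channel P).
  split=> //; split.
    congr diag_mx; apply/rowP => i; rewrite !mxE; case: ifP => _.
      by rewrite PG invrK.
    rewrite mulmxBl mul1mx linearB /= PG gibbs_trace //.
    rewrite -(rmorph1 (real_complex R)) -rmorphB invrK mulrBl mul1r.
    by rewrite mulVf // lt0r_neq0.
  move=> t w _; apply/matrixP => i j; rewrite qubit_evoE.
  rewrite !mxE; have [->|_] := eqVneq i j; last by rewrite !mulr0n mulr0.
  (* Both populations are traces against pinched effects, which do not see the evolution. *)
  rewrite subrr phase0 mul1r PC !pinching_evo_trace.
  by [].
have tE : \tr (measure_channel P rho) = 1 by have [_ [_ ->]] := chE.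
have PP : \tr (P *m rho) = (retr L (pinching H rho))%:C.
  by rewrite -pinching_trace_mul (trace_psd_retr _ _ _ L0 pR0).
rewrite trnorm_ket0_sub //; last first.
  apply: psd_hermitian; have [_ [Ecp _]] := chE; exact: CP_positive.
rewrite !mxE /= ?mulr1n ?mulr0n PP /= ?expr0n /= !addr0 sqrtr_sqr ger0_norm.
  by rewrite mulrC mulKf ?pnatr_eq0.
rewrite subr_ge0; apply: effect_retr_le1 (conj L0 L1) pR0 _.
by rewrite pinching_trace.
Qed.

End Distillation.

(** * Supremum and infimum exchanged by inversion *)

Section LogDuality.
Local Open Scope classical_set_scope.
Context {R : realType}.

(** Here [S] stands for the achievable m and [F] for the values Tr[L gamma] of feasible tests.
    Inversion matches them up to arbitrarily small errors, so sup S = 1 / inf F. The third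
    hypothesis handles tests of value 0, which have no reciprocal of their own but can be approached
    by positive values. *)
Lemma elog2_sup_inf (S F : set R) :
  F 1 -> (forall q, F q -> 0 <= q) ->
  (forall q, F q -> forall eta, 0 < eta ->
     exists2 q', F q' & 0 < q' <= q + eta) ->
  (forall q, F q -> 0 < q -> S q^-1) ->
  (forall m, S m -> 1 <= m /\
     forall eta, 0 < eta -> exists2 q, F q & q <= m^-1 + eta) ->
  elog2 (ereal_sup [set m%:E | m in S]) =
  (- elog2 (ereal_inf [set q%:E | q in F]))%E.
Proof.
move=> F1 F0 Fpos FS SF.
have lbF : has_lbound F by exists 0.
have neF : F !=set0 by exists 1.
have infF : has_inf F by [].
have S1 : S 1 by rewrite -invr1; apply: FS.
rewrite (ereal_inf_EFin lbF neF); set p := inf F.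
have p_ge0 : 0 <= p by apply: lb_le_inf.
have pF q : F q -> p <= q by move=> Fq; exact: ge_inf.
have [p0|p0] := ltP 0 p; last first.
  (* With infimum 0 the right side is +oo, so [S] must be shown unbounded. *)
  have {p_ge0}p0 : p = 0 by apply/eqP; rewrite eq_le p0.
  rewrite p0 /elog2 ltxx /=.
  suff -> : ereal_sup [set m%:E | m in S] = +oo%E by [].
  apply/eqyP => A A0.
  have A2 : 0 < A^-1 / 2 by rewrite divr_gt0 // invr_gt0.
  (* One half of A^-1 is spent on approaching the infimum, the other on making the value
     positive. *)
  have [q Fq qA] := inf_adherent A2 infF.
  have [q' Fq' /andP[q'0 q'A]] := Fpos _ Fq _ A2.
  apply: (le_trans (y := (q'^-1)%:E)); last first.
    by apply: ereal_sup_ubound; exists q'^-1 => //; exact: FS.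
  rewrite lee_fin -[A]invrK lef_pV2 ?posrE ?invr_gt0 //.
  move: qA; rewrite -/p p0; lra.
have ubS m : S m -> m <= p^-1.
  move=> /SF[m1 Sm]; have m0 : 0 < m by rewrite (lt_le_trans ltr01).
  rewrite -[m]invrK lef_pV2 ?posrE ?invr_gt0 //.
  apply/ler_addgt0Pr => eta /Sm[q Fq]; exact/le_trans/pF.
have hubS : has_ubound S by exists p^-1.
rewrite ereal_sup_EFin //; last by exists 1.
set s := sup S.
have s1 : 1 <= s by exact: ub_le_sup.
have s0 : 0 < s by rewrite (lt_le_trans ltr01).
suff -> : s = p^-1 by rewrite /elog2 invr_gt0 p0 lnV ?posrE // mulNr.
apply/eqP; rewrite eq_le; apply/andP; split.
  by apply: ge_sup => //; exists 1.
rewrite -[s]invrK lef_pV2 ?posrE ?invr_gt0 //.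
apply: lb_le_inf => // q Fq.
have q0 : 0 < q by rewrite (lt_le_trans p0) ?pF.
rewrite -[q]invrK lef_pV2 ?posrE ?invr_gt0 //.
by apply: ub_le_sup => //; exact: FS.
Qed.

End LogDuality.

(** * Equality of the distillation rate and the hypothesis testing divergence *)

Theorem theorem6 (R : realType) (beta : R) (n : nat) (HA : 'M[R[i]]_n)
    (rho : 'M[R[i]]_n) (eps : R) :
  (0 < n)%N -> 0 < beta -> is_hermitian HA -> is_state rho ->
  0 <= eps <= 1 ->
  Distill beta HA rho eps = Dmin eps (pinching HA rho) (gibbs beta HA).
Proof.
move=> n0 _ hH rhoS /andP[eps0 eps1].
set G := gibbs beta HA; set S := pinching HA rho.
have G0 : psd G := gibbs_psd beta n HA n0.
have G1 : \tr G = 1 := gibbs_trace beta n HA n0.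
have GC : psd (1%:M - G) := gibbs_psdC beta n HA n0.
have S0 : psd S by apply: psd_pinching; case: rhoS.
have S1 : \tr S = 1 by rewrite /S pinching_trace; case: rhoS.
pose feasible L := effect L /\ 1 - eps <= retr L S.
pose F : set R := [set retr L G | L in feasible]%classic.
have -> : Dmin eps S G = (- elog2 (ereal_inf [set q%:E | q in F]%classic))%E.
  congr (- elog2 (ereal_inf _))%E; rewrite /F image_comp.
  apply/seteqP; split=> [_ [L [L0 [L1 LS]] <-]|_ [L [[L0 L1] LS] <-]];
    by exists L => //=; rewrite retrC.
have FP L : feasible L -> F (retr L G) by move=> fL; exists L.
have F0 q : F q -> 0 <= q by move=> [L [[L0 _] _] <-]; exact: retr_ge0.
have f1 : feasible 1%:M.
  split; last by rewrite retr_state1 // lerBlDr lerDl.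
  by split; [exact: psd1 | rewrite subrr; exact: psd0].
apply: elog2_sup_inf => //.
- by rewrite -(retr_state1 _ _ G1); exact: FP.
- move=> _ [L [eL LS] <-] eta eta0.
  have q0 : 0 <= retr L G by exact: F0 (FP _ (conj eL LS)).
  (* Mixing in weight [s] of the identity keeps feasibility, since the success probability can only
     rise, and puts the value on [G] between s > 0 and its old value plus [eta]. *)
  pose s := Num.min 1 eta.
  have s0 : 0 < s by rewrite lt_min ltr01.
  have s1 : s <= 1 by rewrite ge_min lexx.
  have se : s <= eta by rewrite ge_min lexx orbT.
  have LS1 : retr L S <= 1 := effect_retr_le1 _ _ _ eL S0 S1.
  have LG1 : retr L G <= 1 := effect_retr_le1 _ _ _ eL G0 G1.
  exists (retr ((1 - s)%:C *: L + s%:C *: 1%:M) G).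
    apply: FP; split; first by apply: effect_mix => //; rewrite ltW.
    rewrite retrDl !retrZl retr_state1 //.
    have : 0 <= s * (1 - retr L S) by rewrite mulr_ge0 ?subr_ge0 // ltW.
    move: LS; lra.
  rewrite retrDl !retrZl retr_state1 //; apply/andP; split.
    by rewrite mulr1 ltr_wpDl // mulr_ge0 // subr_ge0.
  have : 0 <= s * retr L G by rewrite mulr_ge0 // ltW.
  lra.
- move=> _ [L [eL LS] <-] q0 /=.
  have LG1 : retr L G <= 1 := effect_retr_le1 _ _ _ eL G0 G1.
  split; first by rewrite invf_ge1.
  have [E gE dE] := effect_GPC beta n HA rho L n0 rhoS eL q0.
  apply: (le_trans (y := (trnorm (ket0proj R - E rho) / 2)%:E)).
    by apply: ereal_inf_lbound; exists E.
  by rewrite lee_fin dE -/S; move: LS; lra.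
- move=> m [m1 dm]; split=> // eta eta0.
  (* No minimizing channel is assumed: for each d > 0 some channel has error below eps + d, and
     [effect_limit] then removes d. *)
  have near (d : R) : 0 < d -> exists2 L, effect L &
      retr L G = m^-1 /\ 1 - (eps + d) <= retr L S.
    move=> d0.
    have : (dGPC HA G rho (H_X beta m) (u_m m) (ket0proj R) < (eps + d)%:E)%E.
      by apply: (le_lt_trans dm); rewrite lte_fin ltrDl.
    move=> /ereal_inf_lt[_ [E gE <-]]; rewrite lte_fin => Ed.
    have [L eL [LG LS]] := GPC_effect beta m n HA G rho E hH rhoS gE.
    by exists L => //; split=> //; apply: le_trans LS; rewrite lerD2l lerN2 ltW.
  have [L eL [LS LG]] :=
    effect_limit n S G m^-1 S0 S1 G0 G1 GC eps eps0 near eta eta0.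
  by exists (retr L G) => //; exact: FP.
Qed.
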